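(* Let $q$ be a power of a prime $p$ and $K$ an algebraic closure of $\mathbb{F}_q$, with $\mathrm{PGL}(3,q)$ and its subgroup $\mathrm{PSL}(3,q)$ acting on $\mathrm{PG}(2,K)$. Every $\mathrm{PSL}(3,q)$-invariant irreducible plane curve of degree smaller than $q^3-q$ is also $\mathrm{PGL}(3,q)$-invariant.
   Context: Plane curves are projective plane curves over $K$; irreducible means irreducible over $K$; a curve is $G$-invariant if every element of $G$ maps it onto itself. *)

(* Defs.v *)
From HB Require Import structures.
From mathcomp Require Import all_boot all_order all_algebra all_field.
From mathcomp Require Import mpoly.
Set Implicit Arguments. Unset Strict Implicit. Unset Printing Implicit Defensive.
Import GRing.Theory.
Local Open Scope ring_scope.

Definition algebraic_over (F : fieldType) (K : fieldType)
  (iota : {rmorphism F -> K}) : Prop :=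
  forall x : K, exists P : {poly F}, P != 0 /\ root (map_poly iota P) x.

(* A projective plane curve over K is given by a homogeneous polynomial in
   X_0, X_1, X_2 (up to a nonzero scalar).  Irreducible = irreducible element
   of the integral domain K[X_0,X_1,X_2]. *)
Definition mirreducible (K : idomainType) (P : {mpoly K[3]}) : Prop :=
  P != 0 /\ P \isn't a GRing.unit /\
  forall G H : {mpoly K[3]}, P = G * H -> G \is a GRing.unit \/ H \is a GRing.unit.

Definition lin_forms (K : ringType) (A : 'M[K]_3) : 3.-tuple {mpoly K[3]} :=
  [tuple \sum_(j < 3) A i j *: 'X_j | i < 3].

Definition mat_act (K : ringType) (A : 'M[K]_3) (P : {mpoly K[3]}) : {mpoly K[3]} :=
  P \mPo lin_forms A.

(* The projectivity of A maps the curve P = 0 onto itself iff the transformed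
   equation is a nonzero scalar multiple of P. *)
Definition fixes_curve (K : fieldType) (A : 'M[K]_3) (P : {mpoly K[3]}) : Prop :=
  exists c : K, c != 0 /\ mat_act A P = c *: P.

(* Invariance under a group of projectivities of PG(2,K) given by a set of
   matrices over F (embedded in K via iota).  Scalar matrices act trivially on
   curves, so invariance under PGL(3,q) = GL(3,q)/Z is invariance under all
   A in GL(3,q), and under PSL(3,q) = SL(3,q)/(Z cap SL) under all A in SL(3,q). *)
Definition curve_invariant (F K : fieldType) (iota : {rmorphism F -> K})
  (G : pred 'M[F]_3) (P : {mpoly K[3]}) : Prop :=
  forall A : 'M[F]_3, G A -> fixes_curve (map_mx iota A) P.

Definition GL3 (F : fieldType) : pred 'M[F]_3 := fun A => A \in unitmx.
Definition SL3 (F : fieldType) : pred 'M[F]_3 := fun A => \det A == 1.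

(* Main.v *)
Require Import Defs.
From HB Require Import structures.
From mathcomp Require Import all_boot all_order all_algebra all_field.
From mathcomp Require Import mpoly zify.
Set Implicit Arguments. Unset Strict Implicit. Unset Printing Implicit Defensive.
Import GRing.Theory.
Local Open Scope ring_scope.

(** Write q = #|F|.  A matrix of GL(3,q) is the product of one of SL(3,q) and D = diag(1,1,t),
    so it suffices that Q := P(x,y,tz) - P vanishes.  Both P and Q are invariant under all
    transvections, and z divides Q.  If k is the exact power of z dividing such a form of degree
    d, then invariance under x -> x + a z and y -> y + a z forces the lowest coefficient
    h(x,y) of z^k to be a polynomial in x^q and y^q, so q | d - k.  Since P is irreducible,
    k = 0 for P, so q | d; hence q | k for Q, and z^q divides Q.  Now Q(1,b,z), for b outside
    F, is invariant under the q^2 translations z -> z + a + a' b, so each of these q^2 points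
    is a zero of multiplicity at least q, whereas the degree is at most d < q^3. *)

(** * Triples of distinct indices *)

Lemma mem_ord3 (i j k l : 'I_3) : uniq [:: i; j; k] -> l \in [:: i; j; k].
Proof.
move=> u; have e : #|[:: i; j; k]| = #|'I_3| by rewrite (card_uniqP u) card_ord.
by rewrite (subset_cardP e (subset_predT _)).
Qed.

Lemma big_ord3 (R : Type) (idx : R) (op : Monoid.com_law idx) (i j k : 'I_3)
    (G : 'I_3 -> R) :
  uniq [:: i; j; k] -> \big[op/idx]_(l < 3) G l = op (G i) (op (G j) (G k)).
Proof.
move=> u; rewrite (perm_big [:: i; j; k]) /=.
  by rewrite !big_cons big_nil Monoid.mulm1.
apply: uniq_perm => [||l]; rewrite ?index_enum_uniq // mem_index_enum.
by rewrite mem_ord3.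
Qed.

Lemma ord3_third (i j : 'I_3) : i != j -> exists k, uniq [:: i; k; j].
Proof.
move=> ij; case: (pickP [predC [:: i; j]]) => [k|none].
  rewrite /= !inE negb_or => /andP[ki kj]; exists k.
  by rewrite /= !inE negb_or eq_sym ki ij kj.
have /subset_leq_card : 'I_3 \subset [:: i; j].
  by apply/subsetP => k _; apply/negbFE/none.
by rewrite card_ord => /leq_trans/(_ (card_size _)).
Qed.

Lemma ord3_complete (i : 'I_3) : exists j k, uniq [:: i; k; j].
Proof.
have [j ij] : exists j, i != j.
  by case: (eqVneq i ord0) => [->|]; [exists ord_max | exists ord0].
by exists j; apply: ord3_third.
Qed.

(** * Univariate polynomials: multiple roots and translations *)

Lemma dvdp_prod_XsubC_exp (K : fieldType) (p : {poly K}) (s : seq K) (k : nat) :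
  uniq s -> (forall a, a \in s -> ('X - a%:P) ^+ k %| p) ->
  \prod_(a <- s) ('X - a%:P) ^+ k %| p.
Proof.
elim: s => [|a s IHs] /=; first by rewrite big_nil dvd1p.
move=> /andP[as_ us] sp; rewrite big_cons Gauss_dvdp.
  by rewrite sp ?mem_head // IHs // => b bs; apply: sp; rewrite inE bs orbT.
rewrite prodrXl coprimep_expl // coprimep_expr //.
by rewrite coprimep_sym coprimep_XsubC root_prod_XsubC.
Qed.

Lemma lead_coef_translate (K : fieldType) (r : {poly K}) (a : K) :
  lead_coef (r \Po ('X + a%:P)) = lead_coef r.
Proof. by rewrite lead_coef_comp ?size_XaddC // lead_coefXaddC expr1n mulr1. Qed.

(* Such a polynomial is a polynomial in X^q - X. *)
Lemma dvdn_degree_of_translation_invariant (F : finFieldType) (K : fieldType)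
    (iota : {rmorphism F -> K}) (r : {poly K}) :
  (forall a, r \Po ('X + (iota a)%:P) = r) -> (#|F| %| (size r).-1)%N.
Proof.
(* [W] is X^q - X, written as a product so that translation by an element of F merely permutes its
   factors. *)
set W : {poly K} := \prod_(x <- [seq iota x | x : F]) ('X - x%:P).
have sW : size W = #|F|.+1 by rewrite size_prod_XsubC size_image.
have W0 : W != 0 by rewrite -size_poly_gt0 sW.
have Wt a : W \Po ('X + (iota a)%:P) = W.
  rewrite /W !big_image rmorph_prod /= (reindex_inj (addIr a)) /=.
  apply: eq_bigr => x _; rewrite comp_polyB comp_polyX comp_polyC rmorphD /=.
  by rewrite polyCD opprD addrACA subrr addr0.
have [n] := ubnP (size r); elim: n r => // n IHn r; rewrite ltnS => srn rt.
have [s1|s1] := leqP (size r) 1.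
  by case: (size r) s1 => [|[]].
(* Translating by -x gives r(x) = r(0) for every x in F. *)
have Wr : W %| r - (r.[0])%:P.
  apply: uniq_roots_dvdp.
    apply/allP => _ /imageP[x _ ->]; rewrite rootE !hornerE.
    by rewrite -{1}(rt (- x)) horner_comp !hornerE rmorphN subrr subrr.
  by rewrite uniq_rootsE map_inj_uniq ?enum_uniq //; apply: fmorph_inj.
have {Wr} /dvdpP[s rE] := Wr.
have srE : size (r - (r.[0])%:P) = size r.
  by rewrite size_polyDl // size_polyN; apply: leq_ltn_trans (size_polyC_leq1 _) s1.
have s0 : s != 0.
  by apply: contraTneq s1 => s0; rewrite -srE rE s0 mul0r size_poly0.
(* The quotient inherits invariance from [r] and [W], and its degree is lower by q, so the induction
   applies to it. *)
have st a : s \Po ('X + (iota a)%:P) = s.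
  apply: (mulIf W0); rewrite -rE -{1}(Wt a) -comp_polyM -rE.
  by rewrite comp_polyB comp_polyC rt.
have sz : size r = (size s + #|F|)%N by rewrite -srE rE size_mul // sW addnS.
have q0 : (0 < #|F|)%N by apply: ltnW (finNzRing_gt1 F).
rewrite sz -(prednK (n := size s)) ?size_poly_gt0 // addSn /= dvdn_addl //.
by apply: IHn => //; apply: leq_trans srn; rewrite sz -addn1 leq_add2l.
Qed.

(** * Substitution by matrices, and transvections *)

Lemma eq_mmap (n : nat) (K S : nzRingType) (f : K -> S) (v w : 'I_n -> S)
    (P : {mpoly K[n]}) :
  v =1 w -> mmap f v P = mmap f w P.
Proof. by move=> vw; apply: eq_bigr => m _; congr (_ * _); apply: mmap1_eq. Qed.

(** Evaluating the transformed form at v is evaluating P at the point A v. The target ring is left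
    free: slices use [{poly {poly K}}], fibres use [{poly K}]. *)
Lemma mmap_mat_act (K : nzRingType) (S : comNzRingType) (f : {rmorphism K -> S})
    (v : 'I_3 -> S) (A : 'M[K]_3) (P : {mpoly K[3]}) :
  mmap f v (mat_act A P) = mmap f (fun i => \sum_j f (A i j) * v j) P.
Proof.
rewrite /mat_act comp_mpolyE [RHS]/mmap rmorph_sum /=; apply: eq_bigr => m _.
rewrite mmapZ; congr (_ * _); rewrite /mmap1 rmorph_prod.
apply: eq_bigr => i _; rewrite rmorphXn /= tnth_mktuple raddf_sum /=.
by congr (_ ^+ _); apply: eq_bigr => j _; rewrite mmapZ mmapX mmap1U.
Qed.

(** Substitution is contravariant, hence the reversed product. *)
Lemma mat_actM (K : comNzRingType) (A B : 'M[K]_3) (P : {mpoly K[3]}) :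
  mat_act A (mat_act B P) = mat_act (B *m A) P.
Proof.
rewrite {1}/mat_act /comp_mpoly mmap_mat_act /mat_act /comp_mpoly /mmap.
apply: eq_bigr => m _; congr (_ * _); apply: mmap1_eq => i.
rewrite !tnth_mktuple.
transitivity (\sum_j \sum_k (B i j * A j k) *: 'X_k : {mpoly K[3]}).
  apply: eq_bigr => j _; rewrite tnth_mktuple mul_mpolyC scaler_sumr.
  by apply: eq_bigr => k _; rewrite scalerA.
by rewrite exchange_big; apply: eq_bigr => k _; rewrite mxE scaler_suml.
Qed.

(** On forms this is the substitution X_i -> X_i + a X_j. *)
Definition transvection (F : nzRingType) (i j : 'I_3) (a : F) : 'M[F]_3 :=
  1%:M + a *: delta_mx i j.

Lemma sum_transvection (F K S : nzRingType) (iota : {rmorphism F -> K})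
    (f : {rmorphism K -> S}) (v : 'I_3 -> S) (i j l : 'I_3) (a : F) :
  \sum_k f (map_mx iota (transvection i j a) l k) * v k
  = v l + (if l == i then f (iota a) * v j else 0).
Proof.
rewrite (eq_bigr (fun k => (if k == l then v l else 0)
    + (if k == j then if l == i then f (iota a) * v j else 0 else 0))).
  by rewrite big_split /= -!big_mkcond !big_pred1_eq.
move=> k _; rewrite !mxE !rmorphD /= mulrDl; congr (_ + _).
  by case: (eqVneq k l) => [->|_]; rewrite !(rmorph1, rmorph0, mul1r, mul0r).
by case: (eqVneq k j) => [->|_]; case: (eqVneq l i) => _ /=;
  rewrite !(rmorph1, rmorph0, mulr1, mulr0, mul0r).
Qed.

Lemma det_transvection (F : comNzRingType) (i j : 'I_3) (a : F) :
  i != j -> \det (transvection i j a) = 1.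
Proof.
have lt_det (k l : 'I_3) (b : F) : (l < k)%N -> \det (transvection k l b) = 1.
  move=> lk; rewrite det_trig.
    apply: big1 => r _; rewrite !mxE eqxx; case: eqP => [->|_].
      by rewrite -val_eqE /= gtn_eqF // mulr0 addr0.
    by rewrite mulr0 addr0.
  apply/is_trig_mxP => r s rs; rewrite !mxE -val_eqE ltn_eqF // add0r.
  case: eqP => [rk|_]; last by rewrite mulr0.
  case: eqP => [sl|_]; last by rewrite mulr0.
  by move: lk; rewrite -rk -sl ltnNge ltnW.
rewrite neq_ltn => /orP[ij|]; last exact: lt_det.
(* The upper triangular case is the transpose of the lower one. *)
rewrite -det_tr -(lt_det _ _ a ij); congr (\det _).
by apply/matrixP => r s; rewrite !mxE eq_sym andbC.
Qed.

(** * Slices of a form *)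

(* The coefficient of X_i1 ^ n in P, as a polynomial in X_i0, after setting the third variable
   to 1. *)
Definition slice (K : nzRingType) (i0 i1 : 'I_3) (n : nat) (P : {mpoly K[3]}) : {poly K} :=
  \sum_(m <- msupp P | m i1 == n) P@_m *: 'X^(m i0).

Section Slice.
Variables (K : fieldType) (i0 i1 i2 : 'I_3).
Hypothesis u : uniq [:: i0; i1; i2].

(** Dehomogenization X_i2 = 1, with X_i1 as outer variable and X_i0 replaced by p. Taking p = X or p
    = X + a compares a slice with its translate. *)
Let v (p : {poly K}) (k : 'I_3) : {poly {poly K}} :=
  if k == i0 then p%:P else if k == i1 then 'X else 1.

Lemma ord3_neq : [/\ i1 != i0, i2 != i0 & i2 != i1].
Proof.
move: u; rewrite /= !inE negb_or andbT => /andP[/andP[]].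
by rewrite ![_ == i0]eq_sym (eq_sym i2); split.
Qed.

Lemma mnm_ord3 (m : 'X_{1..3}) (d : nat) : mdeg m = d -> (m i0 + m i1 + m i2 = d)%N.
Proof. by rewrite mdegE (big_ord3 _ _ u) /= addnA. Qed.

Lemma coef_mmap_slice (p : {poly K}) (P : {mpoly K[3]}) (n : nat) :
  (mmap (polyC \o polyC) (v p) P)`_n = slice i0 i1 n P \Po p.
Proof.
have [n10 n20 n21] := ord3_neq.
rewrite /mmap coef_sum /slice [in RHS]big_mkcond rmorph_sum; apply: eq_bigr => m _.
rewrite /mmap1 (big_ord3 _ _ u) /v /= !eqxx (negPf n10) (negPf n20) (negPf n21).
rewrite expr1n mulr1 -polyC_exp mulrA -polyCM coefCM coefXn eq_sym.
case: eqP => _; last by rewrite mulr0 comp_poly0.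
by rewrite mulr1 comp_polyZ rmorphXn /= comp_polyX mul_polyC.
Qed.

(** Once X_i2 = 1, the substitution X_i0 -> X_i0 + a X_i2 is translation by a; it leaves X_i1 alone,
    so it acts on each slice separately. *)
Lemma slice_transvection (F : fieldType) (iota : {rmorphism F -> K}) (P : {mpoly K[3]})
    (a : F) (c : K) (n : nat) :
  mat_act (map_mx iota (transvection i0 i2 a)) P = c *: P ->
  slice i0 i1 n P \Po ('X + (iota a)%:P) = c *: slice i0 i1 n P.
Proof.
have [n10 n20 n21] := ord3_neq.
move=> /(congr1 (mmap (polyC \o polyC) (v 'X))); rewrite mmap_mat_act mmapZ /=.
move=> /(congr1 (fun q : {poly {poly K}} => q`_n)); rewrite coefCM coef_mmap_slice comp_polyXr mul_polyC => <-.
rewrite -coef_mmap_slice; congr (nth 0 (polyseq _) n); apply: eq_mmap => k.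
rewrite [RHS](sum_transvection iota (polyC \o polyC)) /v /=.
case: (eqVneq k i0) => _; last by rewrite addr0.
by rewrite (negPf n20) (negPf n21) /= mulr1 -polyCD.
Qed.

(** In a form of degree d the exponents of X_i0 and X_i1 determine that of X_i2, so no two monomials
    merge in a slice. *)
Lemma coef_slice (P : {mpoly K[3]}) (d : nat) (m : 'X_{1..3}) :
  P \is d.-homog -> mdeg m = d -> (slice i0 i1 (m i1) P)`_(m i0) = P@_m.
Proof.
move=> /dhomogP dP dm; rewrite /slice coef_sum.
have Pm m' : m' \in msupp P -> m' i1 == m i1 -> m i0 == m' i0 -> m' = m.
  move=> /dP dm' /eqP e1 /eqP e0.
  have e2 : m' i2 = m i2.
    by have := mnm_ord3 dm'; rewrite -(mnm_ord3 dm) e0 e1 => /addnI.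
  apply/mnmP => k; have := mem_ord3 k u.
  by rewrite !inE => /or3P[] /eqP ->.
rewrite big_mkcond; have [ms|ms] := boolP (m \in msupp P).
  rewrite (bigD1_seq m) //= ?msupp_uniq // eqxx coefZ coefXn eqxx mulr1.
  rewrite big1_seq ?addr0 // => m' /andP[ne m's]; case: ifP => // e1.
  rewrite coefZ coefXn; case: eqP => [/eqP e0|]; last by rewrite mulr0.
  by rewrite (Pm m') ?eqxx in ne.
rewrite (memN_msupp_eq0 ms) big1_seq // => m' /= m's; case: ifP => // e1.
rewrite coefZ coefXn; case: eqP => [/eqP e0|]; last by rewrite mulr0.
by rewrite -(Pm m') // m's in ms.
Qed.

Lemma slice_neq0 (P : {mpoly K[3]}) (d : nat) (m : 'X_{1..3}) :
  P \is d.-homog -> m \in msupp P -> slice i0 i1 (m i1) P != 0.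
Proof.
move=> dP ms; apply/eqP => s0; move: (ms).
by rewrite mcoeff_msupp -(coef_slice dP (dhomog_mf dP ms)) s0 coef0 eqxx.
Qed.

(** A translation keeps the leading coefficient of a nonzero slice, which forces the multiplier c to
    be 1. *)
Lemma transvection_semi_invariant (F : fieldType) (iota : {rmorphism F -> K})
    (P : {mpoly K[3]}) (d : nat) (a : F) (c : K) :
  P \is d.-homog -> mat_act (map_mx iota (transvection i0 i2 a)) P = c *: P ->
  mat_act (map_mx iota (transvection i0 i2 a)) P = P.
Proof.
move=> dP cP; rewrite cP.
have [->|P0] := eqVneq P 0; first by rewrite scaler0.
have ms := mlead_supp P0; have s0 := slice_neq0 dP ms.
have /(congr1 lead_coef) := slice_transvection (mlead P i1) cP.
rewrite lead_coef_translate lead_coefZ -[LHS]mul1r => /mulIf <-; first exact: scale1r.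
by rewrite lead_coef_eq0.
Qed.

(** Among monomials with the same exponent of X_i1, the least exponent of X_i2 means the greatest
    exponent of X_i0. So the slice through m has degree exactly [m i0], and it is invariant under
    translation by F. *)
Lemma dvdn_exponent_of_transvection_invariant (F : finFieldType)
    (iota : {rmorphism F -> K}) (P : {mpoly K[3]}) (d : nat) (m : 'X_{1..3}) :
  P \is d.-homog ->
  (forall a, mat_act (map_mx iota (transvection i0 i2 a)) P = P) ->
  m \in msupp P -> (forall m', m' \in msupp P -> m i2 <= m' i2)%N ->
  (#|F| %| m i0)%N.
Proof.
move=> dP tP ms mmin; have dm := dhomog_mf dP.
suff sz : size (slice i0 i1 (m i1) P) = (m i0).+1.
  rewrite -[m i0]/(m i0).+1.-1 -sz.
  apply: (@dvdn_degree_of_translation_invariant _ _ iota) => a.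
  by rewrite (slice_transvection (c := 1)) ?scale1r.
apply/eqP; rewrite eqn_leq; apply/andP; split; last first.
  rewrite ltnNge; apply/negP => /leq_sizeP/(_ _ (leqnn _)).
  by apply/eqP; rewrite (coef_slice dP (dm _ ms)) -mcoeff_msupp.
rewrite /slice big_seq_cond; apply: leq_trans (size_sum _ _ _) _.
apply/bigmax_leqP_seq => m' _ /andP[m's /eqP e1].
apply: leq_trans (size_scale_leq _ _) _; rewrite size_polyXn ltnS.
have := mnm_ord3 (dm _ m's); rewrite -(mnm_ord3 (dm _ ms)) e1 => e.
by have := mmin _ m's; lia.
Qed.


(** * Fibres and the vanishing criterion *)

(* P restricted to X_i1 = b, X_i2 = 1. *)
Definition fiber (b : K) (P : {mpoly K[3]}) : {poly K} :=
  \sum_(m <- msupp P) (P@_m * b ^+ m i1) *: 'X^(m i0).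

Let w (b : K) (p : {poly K}) (k : 'I_3) : {poly K} :=
  if k == i0 then p else if k == i1 then b%:P else 1.

Lemma mmap_fiber (b : K) (p : {poly K}) (P : {mpoly K[3]}) :
  mmap polyC (w b p) P = fiber b P \Po p.
Proof.
have [n10 n20 n21] := ord3_neq.
rewrite /mmap /fiber rmorph_sum; apply: eq_bigr => m _.
rewrite /mmap1 (big_ord3 _ _ u) /w /= !eqxx (negPf n10) (negPf n20) (negPf n21).
rewrite expr1n mulr1 comp_polyZ rmorphXn /= comp_polyX -mul_polyC polyCM polyC_exp.
by rewrite -mulrA; congr (_ * _); rewrite mulrC.
Qed.

(** Each coefficient of the fibre is polynomial in b, so a nonzero form has a nonzero fibre for all
    but finitely many b. *)
Lemma coef_fiber (b : K) (P : {mpoly K[3]}) (n : nat) :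
  (fiber b P)`_n = (slice i1 i0 n P).[b].
Proof.
rewrite /fiber /slice coef_sum horner_sum [RHS]big_mkcond; apply: eq_bigr => m _.
rewrite coefZ coefXn eq_sym; case: eqP => _; last by rewrite mulr0.
by rewrite mulr1 !hornerE.
Qed.

Lemma fiber_transvection (F : fieldType) (iota : {rmorphism F -> K}) (b : K)
    (P : {mpoly K[3]}) (a : F) (j : 'I_3) :
  j != i0 -> mat_act (map_mx iota (transvection i0 j a)) P = P ->
  fiber b P \Po ('X + (iota a * (if j == i1 then b else 1))%:P) = fiber b P.
Proof.
move=> ji0 /(congr1 (mmap polyC (w b 'X))); rewrite mmap_mat_act.
rewrite mmap_fiber comp_polyXr => {2}<-; rewrite -mmap_fiber; apply: eq_mmap => k.
rewrite [RHS](sum_transvection iota polyC) /w /= (negPf ji0).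
case: (eqVneq k i0) => _; last by rewrite addr0.
by rewrite polyCM; case: eqP.
Qed.

(** The fibre has a zero of multiplicity at least q at 0, hence at each of the q^2 translates of 0
    by F + F b. A nonzero fibre would then have degree at least q^3 > d. *)
Lemma fiber_eq0 (F : finFieldType) (iota : {rmorphism F -> K}) (b : K)
    (P : {mpoly K[3]}) (d : nat) :
  P \is d.-homog -> (d < #|F| ^ 3)%N -> (forall x, b != iota x) ->
  (forall j a, j != i0 -> mat_act (map_mx iota (transvection i0 j a)) P = P) ->
  (forall m, m \in msupp P -> #|F| <= m i0)%N ->
  fiber b P = 0.
Proof.
have [n10 n20 n21] := ord3_neq.
move=> dP dq bF tP Pq; apply: contraTeq dq => f0; rewrite -leqNgt.
pose g (p : F * F) := iota p.1 + iota p.2 * b.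
have g_inj : injective g.
  move=> [x y] [x' y'] /= /eqP; rewrite /g /= -subr_eq0 opprD addrACA -mulrBl.
  rewrite -!rmorphB; have [->|yy'] := eqVneq y y'.
    by rewrite subrr rmorph0 mul0r addr0 fmorph_eq0 subr_eq0 => /eqP->.
  rewrite addrC addr_eq0 => /eqP/(canRL (mulKf _)) bE.
  (* A coincidence x + y b = x' + y' b with y != y' would express b as a quotient in F. *)
  have /eqP[] := bF (- (x - x') / (y - y')).
  rewrite fmorph_div rmorphN mulrC; apply: bE.
  by rewrite fmorph_eq0 subr_eq0.
(* Translation by x + y b composes X_i0 -> X_i0 + x X_i2 with X_i0 -> X_i0 + y X_i1. *)
have gt p : fiber b P \Po ('X + (g p)%:P) = fiber b P.
  have := fiber_transvection b n20 (tP _ p.1 n20).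
  rewrite (negPf n21) mulr1 => t1; have := fiber_transvection b n10 (tP _ p.2 n10).
  by rewrite eqxx => t2; rewrite -[RHS]t1 -[in RHS]t2 -comp_polyA comp_polyD
    comp_polyX comp_polyC -addrA -polyCD.
have Xf : 'X^#|F| %| fiber b P.
  rewrite /fiber big_seq; apply: (big_ind (fun r => 'X^#|F| %| r)).
  - exact: dvdp0.
  - by move=> ? ?; apply: dvdp_add.
  by move=> m /Pq qm; rewrite -mul_polyC dvdp_mull ?dvdp_exp2l.
have : \prod_(a <- [seq g p | p : F * F]) ('X - a%:P) ^+ #|F| %| fiber b P.
  apply: dvdp_prod_XsubC_exp; first by rewrite map_inj_uniq ?enum_uniq.
  move=> _ /imageP[p _ ->]; have := dvdp_comp_poly ('X - (g p)%:P) Xf.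
  have gN : - g p = g (- p.1, - p.2) by rewrite /g /= !rmorphN mulNr opprD.
  by rewrite rmorphXn /= comp_polyX -polyCN gN gt.
move=> /(dvdp_leq f0); rewrite prodrXl => le_f.
have /leq_trans : (#|F| ^ 3 < size (fiber b P))%N.
  apply: leq_trans le_f.
  rewrite -[size _]prednK ?size_poly_gt0 ?expf_neq0 //; last first.
    by rewrite -size_poly_gt0 size_prod_XsubC.
  by rewrite size_exp size_prod_XsubC size_image card_prod /= -!mulnA.
(* It remains to bound the size by d + 1: every exponent of X_i0 is at most d. *)
move=> /(_ d.+1); rewrite ltnS; apply.
rewrite /fiber; apply: leq_trans (size_sum _ _ _) _.
apply/bigmax_leqP_seq => m ms _; apply: leq_trans (size_scale_leq _ _) _.
by rewrite size_polyXn ltnS -(mnm_ord3 (dhomog_mf dP ms)) -addnA leq_addr.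
Qed.

End Slice.

(** If P were nonzero, some b outside F would avoid the roots of a nonzero slice; the fibre over b
    would be nonzero, against [fiber_eq0]. *)
Lemma transvection_invariant_eq0 (F : finFieldType) (K : closedFieldType)
    (iota : {rmorphism F -> K}) (i0 : 'I_3) (P : {mpoly K[3]}) (d : nat) :
  P \is d.-homog -> (d < #|F| ^ 3)%N ->
  (forall j a, j != i0 -> mat_act (map_mx iota (transvection i0 j a)) P = P) ->
  (forall m, m \in msupp P -> #|F| <= m i0)%N ->
  P = 0.
Proof.
move=> dP dq tP Pq; apply/eqP/negPn/negP => P0.
have [i2 [i1 u]] := ord3_complete i0.
have u' : uniq [:: i1; i0; i2].
  rewrite (@perm_uniq _ _ [:: i0; i1; i2]) //.
  by apply/permP => p /=; rewrite addnCA.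
(* The swapped indices give a slice in the variable X_i1, whose value at b is a coefficient of the
   fibre. *)
have s0 := slice_neq0 u' dP (mlead_supp P0).
pose W : {poly K} := \prod_(x <- [seq iota x | x : F]) ('X - x%:P).
have W0 : W != 0 by rewrite -size_poly_gt0 size_prod_XsubC.
(* The factor [W] makes a single non-root avoid both F and the roots of the slice. *)
have /closed_nonrootP[b] : slice i1 i0 (mlead P i0) P * W != 0 by rewrite mulf_neq0.
rewrite rootM root_prod_XsubC negb_or => /andP[sb bF]; case/negP: sb.
rewrite rootE -coef_fiber (fiber_eq0 (iota := iota) u dP dq) ?coef0 // => x.
by apply: contraNneq bF => ->; apply: image_f.
Qed.

(** * The matrices diag(1,1,t) *)

Definition diag_last (K : nzRingType) (t : K) : 'M[K]_3 :=
  diag_mx (\row_k if k == ord_max then t else 1).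

Lemma det_diag_last (K : comNzRingType) (t : K) : \det (diag_last t) = t.
Proof.
rewrite det_diag (bigD1 ord_max) //= !mxE eqxx big1 ?mulr1 // => k /negPf.
by rewrite mxE => ->.
Qed.

Lemma diag_lastM (K : nzRingType) (s t : K) :
  diag_last s *m diag_last t = diag_last (s * t).
Proof.
rewrite /diag_last mulmx_diag; congr diag_mx; apply/rowP => k; rewrite !mxE.
by case: ifP; rewrite ?mulr1.
Qed.

Lemma map_diag_last (F K : nzRingType) (iota : {rmorphism F -> K}) (t : F) :
  map_mx iota (diag_last t) = diag_last (iota t).
Proof.
rewrite /diag_last map_diag_mx; congr diag_mx; apply/rowP => k; rewrite !mxE.
by case: ifP; rewrite ?rmorph1.
Qed.

Lemma mat_act_diag_last (K : comNzRingType) (t : K) (P : {mpoly K[3]}) :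
  mat_act (diag_last t) P = \sum_(m <- msupp P) (t ^+ m ord_max * P@_m) *: 'X_[m].
Proof.
rewrite /mat_act comp_mpolyE; apply: eq_bigr => m _; rewrite mulrC -scalerA.
congr (_ *: _); rewrite mpolyXE_id.
under eq_bigr => i _.
  rewrite tnth_mktuple (bigD1 i) //= big1 ?addr0; last first.
    by move=> j /negPf ji; rewrite !mxE [i == j]eq_sym ji mulr0n scale0r.
  rewrite !mxE eqxx mulr1n exprZn.
  over.
rewrite /= scaler_prod; congr (_ *: _).
rewrite (bigD1 ord_max) //= ?eqxx big1 ?mulr1 // => i /negPf ->.
by rewrite expr1n.
Qed.

(** Monomials free of the last variable keep their coefficient, so the transformed form minus P is
    divisible by that variable. *)
Lemma mcoeff_mat_act_diag_last (K : comNzRingType) (t : K) (P : {mpoly K[3]})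
    (m : 'X_{1..3}) :
  (mat_act (diag_last t) P)@_m = t ^+ m ord_max * P@_m.
Proof.
rewrite mat_act_diag_last raddf_sum /=.
have [ms|ms] := boolP (m \in msupp P).
  rewrite (bigD1_seq m) ?msupp_uniq //= mcoeffZ mcoeffX eqxx mulr1.
  by rewrite big1 ?addr0 // => m' /negPf m'm; rewrite mcoeffZ mcoeffX m'm mulr0.
rewrite (memN_msupp_eq0 ms) mulr0 big1_seq // => m' /= m's.
by rewrite mcoeffZ mcoeffX; case: eqP => [e|_]; rewrite ?mulr0 // -e m's in ms *.
Qed.

(** * Forms fixed by all transvections *)

(** Invariance is exact, not up to a scalar, so that it passes to differences. *)
Definition transvection_invariant (F K : fieldType) (iota : {rmorphism F -> K})
    (P : {mpoly K[3]}) : Prop :=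
  forall i j a, i != j -> mat_act (map_mx iota (transvection i j a)) P = P.

Lemma transvection_invariantB (F K : fieldType) (iota : {rmorphism F -> K})
    (P Q : {mpoly K[3]}) :
  transvection_invariant iota P -> transvection_invariant iota Q ->
  transvection_invariant iota (P - Q).
Proof.
move=> tP tQ i j a ij.
by rewrite -[in RHS](tP i j a ij) -[in RHS](tQ i j a ij) /mat_act raddfB.
Qed.

Lemma SL3_transvection_invariant (F K : fieldType) (iota : {rmorphism F -> K})
    (P : {mpoly K[3]}) (d : nat) :
  P \is d.-homog -> curve_invariant iota (@SL3 F) P -> transvection_invariant iota P.
Proof.
move=> dP sP i j a ij; have [k u] := ord3_third ij.
have [|c [_ cP]] := sP (transvection i j a); first by rewrite /SL3 det_transvection.
exact: (transvection_semi_invariant u dP cP).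
Qed.

Lemma SL3_invariant_diag_last (F K : fieldType) (iota : {rmorphism F -> K})
    (P : {mpoly K[3]}) (t : F) :
  t != 0 -> curve_invariant iota (@SL3 F) P ->
  curve_invariant iota (@SL3 F) (mat_act (diag_last (iota t)) P).
Proof.
move=> t0 sP A; rewrite /SL3 => /eqP dA.
have D1 : diag_last t^-1 *m diag_last t = 1%:M :> 'M[F]_3.
  rewrite diag_lastM mulVf // -[RHS]diag_const_mx; congr diag_mx.
  by apply/rowP => k; rewrite !mxE if_same.
(* SL(3,q) is normal in GL(3,q): the conjugate of A acts on P with the multiplier that A has on the
   transformed form. *)
have [|c [c0 cP]] := sP (diag_last t *m A *m diag_last t^-1).
  by rewrite /SL3 !det_mulmx !det_diag_last dA mulr1 mulfV.
exists c; split=> //; rewrite mat_actM -map_diag_last -map_mxM.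
rewrite -[diag_last t *m A]mulmx1 -D1 mulmxA map_mxM -mat_actM cP.
by rewrite /mat_act linearZ.
Qed.

Lemma dhomog_mat_act_diag_last (K : comNzRingType) (t : K) (P : {mpoly K[3]}) (d : nat) :
  P \is d.-homog -> mat_act (diag_last t) P \is d.-homog.
Proof.
move=> dP; apply/dhomogP => m; rewrite mcoeff_msupp mcoeff_mat_act_diag_last.
move=> tm; apply: (dhomog_mf dP); rewrite mcoeff_msupp.
by apply: contraNneq tm => ->; rewrite mulr0.
Qed.

Lemma mpolyX_dvd (K : idomainType) (n : nat) (P : {mpoly K[n]}) (i : 'I_n) :
  (forall m, m \in msupp P -> 0 < m i)%N -> exists Q, P = 'X_i * Q.
Proof.
move=> Pi; exists (\sum_(m <- msupp P) P@_m *: 'X_[m - U_(i)]).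
rewrite mulr_sumr {1}[P]mpolyE; apply: eq_big_seq => m ms.
rewrite -scalerAr -mpolyXD addmC submK //; apply/mnm_lepP => j.
by rewrite mnm1E; case: eqP => // <-; apply: Pi.
Qed.

Lemma mpolyX_nonunit (K : idomainType) (n : nat) (i : 'I_n) :
  ('X_i : {mpoly K[n]}) \isn't a GRing.unit.
Proof.
apply/negP => /andP[/eqP e _]; move/(congr1 (mcoeff U_(i))): e.
rewrite mcoeffC mcoeffX eqxx mcoeffX mnm1_eq0 => /eqP.
by rewrite mul0r oner_eq0.
Qed.

(** Otherwise X_i divides P, and irreducibility leaves P = c X_i. The exponent of X_i in its only
    monomial is 1, which q would have to divide. *)
Lemma not_dvd_of_transvection_invariant (F : finFieldType) (K : fieldType)
    (iota : {rmorphism F -> K}) (P : {mpoly K[3]}) (d : nat) (i : 'I_3) :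
  P \is d.-homog -> mirreducible P -> transvection_invariant iota P ->
  exists2 m, m \in msupp P & m i = 0%N.
Proof.
move=> dP [P0 [_ irrP]] tP.
have [/hasP[m ms /eqP mi]|/hasPn none] :=
  boolP (has (fun m : 'X_{1..3} => m i == 0%N) (msupp P)).
  by exists m.
have [|Q PE] := @mpolyX_dvd _ _ P i; first by move=> m /none; rewrite lt0n.
have [Xu|] := irrP _ _ PE; first by have := mpolyX_nonunit K i; rewrite Xu.
move=> /andP[/eqP QE _]; exfalso.
set c := Q@_0 in QE; have c0 : c != 0.
  by apply: contraNneq P0 => c0; rewrite PE QE c0 mpolyC0 mulr0.
have {}PE : P = c *: 'X_i by rewrite PE QE mulrC mul_mpolyC.
have Ps : msupp P =i [:: U_(i)%MM].
  by move=> m; rewrite PE (perm_mem (msuppZ _ _)) ?msuppX.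
have [j [k u]] := ord3_complete i; have ji : i != j by rewrite eq_sym; case: (ord3_neq u).
have := dvdn_exponent_of_transvection_invariant u dP (fun a => tP i j a ji) (m := U_(i)%MM).
rewrite Ps mem_head !mnm1E eqxx (negPf ji) dvdn1 => /(_ isT) q1.
by have := finNzRing_gt1 F; rewrite (eqP (q1 _)).
Qed.

(** The difference [d - m i] is the sum of the two other exponents of m, each divisible by q because
    m has the least exponent of X_i. *)
Lemma dvdn_degree_of_min_exponent (F : finFieldType) (K : fieldType)
    (iota : {rmorphism F -> K}) (P : {mpoly K[3]}) (d : nat) (m : 'X_{1..3}) (i : 'I_3) :
  P \is d.-homog -> transvection_invariant iota P ->
  m \in msupp P -> (forall m', m' \in msupp P -> m i <= m' i)%N ->
  (#|F| %| d - m i)%N.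
Proof.
move=> dP tP ms mmin.
have [j [k u]] := ord3_complete i; have ji : i != j by rewrite eq_sym; case: (ord3_neq u).
have q x y : uniq [:: x; y; i] -> (#|F| %| m x)%N.
  move=> uxy; apply: (dvdn_exponent_of_transvection_invariant (iota := iota) uxy dP) => // a.
  by apply: tP; move: uxy; rewrite /= !inE negb_or => /andP[/andP[]].
have ukj : uniq [:: k; j; i].
  rewrite (@perm_uniq _ _ [:: i; k; j]) //; apply/permP => p /=.
  by rewrite !addn0 addnA addnC.
have ujk : uniq [:: j; k; i] by rewrite -rev_uniq.
rewrite -(mnm_ord3 ukj (dhomog_mf dP ms)) addnK dvdn_add //; first exact: q ukj.
exact: q ujk.
Qed.

(** * From SL(3,q) to GL(3,q) *)

Lemma mat_act_diag_last_invariant (F : finFieldType) (K : closedFieldType)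
    (iota : {rmorphism F -> K}) (P : {mpoly K[3]}) (d : nat) (t : F) :
  P \is d.-homog -> mirreducible P -> (d < #|F| ^ 3)%N -> t != 0 ->
  curve_invariant iota (@SL3 F) P ->
  mat_act (diag_last (iota t)) P = P.
Proof.
move=> dP irrP dq t0 sP; set Q := mat_act _ P; apply/eqP; rewrite -subr_eq0; apply/eqP.
have tP := SL3_transvection_invariant dP sP.
have dQ : Q \is d.-homog by apply: dhomog_mat_act_diag_last.
have tQ := SL3_transvection_invariant dQ (SL3_invariant_diag_last t0 sP).
have dQP : Q - P \is d.-homog by rewrite rpredB.
have tQP := transvection_invariantB tQ tP.
apply: (transvection_invariant_eq0 (iota := iota) (i0 := ord_max) dQP dq).
  by move=> j a; rewrite eq_sym; apply: tQP.
move=> m0 m0s.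
(* Some monomial of P omits the last variable, so the least exponent is 0. *)
have qd : (#|F| %| d)%N.
  have [m ms m2] := not_dvd_of_transvection_invariant ord_max dP irrP tP.
  rewrite -[d]subn0 -m2.
  by apply: dvdn_degree_of_min_exponent dP tP ms _ => m'; rewrite m2.
have exm : exists n, has (fun m : 'X_{1..3} => m ord_max == n) (msupp (Q - P)).
  by exists (m0 ord_max); apply/hasP; exists m0.
case: (ex_minnP exm) => n /hasP[m ms /eqP mn] nmin.
have mmin m' : m' \in msupp (Q - P) -> (m ord_max <= m' ord_max)%N.
  by move=> m's; rewrite mn; apply: nmin; apply/hasP; exists m'.
(* It suffices that q divides the least exponent and that this exponent is positive; at exponent 0
   the coefficients of [Q] and P cancel. *)
apply: leq_trans (mmin _ m0s); apply: dvdn_leq.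
  rewrite lt0n; apply: contraTneq ms => m2.
  by rewrite mcoeff_msupp mcoeffB mcoeff_mat_act_diag_last m2 mul1r subrr eqxx.
have md : (m ord_max <= d)%N.
  by rewrite -(dhomog_mf dQP ms) /= mdegE (bigD1 ord_max) //= leq_addr.
by rewrite -(dvdn_subr md) //; apply: dvdn_degree_of_min_exponent dQP tQP ms mmin.
Qed.

Theorem mainTheorem8 (F : finFieldType) (K : closedFieldType)
  (iota : {rmorphism F -> K}) (K_alg : algebraic_over iota)
  (P : {mpoly K[3]}) (d : nat) :
  P \is d.-homog -> mirreducible P ->
  (d < #|F| ^ 3 - #|F|)%N ->
  curve_invariant iota (@SL3 F) P ->
  curve_invariant iota (@GL3 F) P.
Proof.
move=> dP irrP dq sP A; rewrite /GL3 unitmxE unitfE => t0.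
(* Dividing the last column of A by det A gives an element of SL(3,q); its multiplier c also serves
   for A. *)
have [|c [c0 cP]] := sP (A *m diag_last (\det A)^-1).
  by rewrite /SL3 det_mulmx det_diag_last mulfV.
exists c; split=> //.
have {2}<- : mat_act (diag_last (iota (\det A))) P = P.
  by apply: (mat_act_diag_last_invariant dP) => //; apply: leq_trans dq (leq_subr _ _).
have AE : A = A *m diag_last (\det A)^-1 *m diag_last (\det A).
  rewrite -mulmxA diag_lastM mulVf // -[LHS]mulmx1 -diag_const_mx; congr (_ *m diag_mx _).
  by apply/rowP => k; rewrite !mxE if_same.
by rewrite {1}AE map_mxM -mat_actM cP map_diag_last /mat_act linearZ.
Qed.
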